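(* Let $1\le p<2$, let $N\in\mathbb N$, $d,n\ge 1$, and let $f_1,\dots,f_d\colon\mathbb R^n\to\mathbb R^n$ be of class $C^2_b$ with $\max_{\mu=1,\dots,d}\|f_\mu\|_{C^2_b}\le L$ for some constant $L>0$. Let $\mathbf w=(\mathbf w_0,\dots,\mathbf w_N)$ and $\tilde{\mathbf w}=(\tilde{\mathbf w}_0,\dots,\tilde{\mathbf w}_N)$ be time series in $\mathbb R^d$, let $\xi,\tilde\xi\in\mathbb R^n$, and let $\mathbf x,\tilde{\mathbf x}$ be the solutions of \[ \mathbf x_{k+1}=\mathbf x_k+\sum_{\mu=1}^d f_\mu(\mathbf x_k)(\mathbf w^\mu_{k+1}-\mathbf w^\mu_k),\quad \mathbf x_0=\xi,\qquad \tilde{\mathbf x}_{k+1}=\tilde{\mathbf x}_k+\sum_{\mu=1}^d f_\mu(\tilde{\mathbf x}_k)(\tilde{\mathbf w}^\mu_{k+1}-\tilde{\mathbf w}^\mu_k),\quad \tilde{\mathbf x}_0=\tilde\xi, \] for $k=0,\dots,N-1$. Then \[ \sup_{k=0,\dots,N}|\mathbf x_k-\tilde{\mathbf x}_k|\le 2c_{p,N}^{1/p}\exp\!\Big(c_{p,N}L^p\big(\|\mathbf w\|_{p;[0,N]}^p+\|\tilde{\mathbf w}\|_{p;[0,N]}^p\big)\Big)\big(|\xi-\tilde\xi|+L\|\mathbf w-\tilde{\mathbf w}\|_{p;[0,N]}\big), \] where $c_{p,N}\coloneqq(4e^2)^p\big(4^{p-1}C_{p,N}^p+1\big)$ and $C_{p,N}\coloneqq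 2^{2/p}\zeta_N(2/p)$, with $\zeta_N(s)\coloneqq\sum_{j=1}^N j^{-s}$.
   Context: $\mathbb R^n$ carries a fixed norm $|\cdot|$ and $\mathbb R^d$ carries the $\ell^1$ norm $|a|=\sum_\mu|a^\mu|$; derivatives are measured in the induced operator norms. For $g\colon\mathbb R^n\to\mathbb R^n$, $\|g\|_{C^2_b}\coloneqq\max_{j=0,1,2}\|D^jg\|_\infty$ (with $D^0g=g$), and $C^2_b$ is the class of $C^2$ maps for which this is finite. A time series is a finite sequence $\mathbf w=(\mathbf w_0,\dots,\mathbf w_N)$; upper indices denote components. For $0\le k<l\le N$, $\mathcal S_{k,l}$ is the set of all increasing sequences $s=(s_0=k<s_1<\dots<s_m<s_{m+1}=l)$ of integers, with $\#s\coloneqq m$, and the $p$-variation is $\|\mathbf w\|_{p;[k,l]}\coloneqq\big(\max_{s\in\mathcal S_{k,l}}\sum_{j=0}^{\#s}|\mathbf w_{s_{j+1}}-\mathbf w_{s_j}|^p\big)^{1/p}$. *)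

(* Defs.v *)
From HB Require Import structures.
From mathcomp Require Import all_boot all_order all_algebra.
From mathcomp Require Import all_classical all_reals all_analysis.
Set Implicit Arguments. Unset Strict Implicit. Unset Printing Implicit Defensive.
Import Order.TTheory GRing.Theory Num.Theory.
Import numFieldNormedType.Exports.
Local Open Scope classical_set_scope.
Local Open Scope ring_scope.

Section Defs.
Variable R : realType.

Definition is_norm (n : nat) (nrm : 'rV[R]_n -> R) : Prop :=
  [/\ forall x, nrm x = 0 -> x = 0,
      forall (a : R) x, nrm (a *: x) = `|a| * nrm x
    & forall x y, nrm (x + y) <= nrm x + nrm y].

Definition l1norm (d : nat) (a : 'rV[R]_d) : R := \sum_(mu < d) `|a 0 mu|.

Definition D2 (n : nat) (g : 'rV[R]_n -> 'rV[R]_n) (x v w : 'rV[R]_n) :=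
  'd (fun y => 'd g y v) x w.

(* g is of class C^2 (Frechet); in finite dimension this is the coordinate
   unfolding: g differentiable, each x |-> Dg(x)v differentiable, and each
   x |-> D^2 g(x)[v,w] continuous. *)
Definition C2 (n : nat) (g : 'rV[R]_n -> 'rV[R]_n) : Prop :=
  [/\ forall x, differentiable g x,
      forall v x, differentiable (fun y => 'd g y v) x
    & forall v w, continuous (fun x => D2 g x v w)].

(* ||g||_{C^2_b} <= L, derivatives measured in operator norms induced by nrm *)
Definition C2b_le (n : nat) (nrm : 'rV[R]_n -> R) (g : 'rV[R]_n -> 'rV[R]_n)
  (L : R) : Prop :=
  [/\ C2 g,
      forall x, nrm (g x) <= L,
      forall x v, nrm ('d g x v) <= L * nrm v
    & forall x v w, nrm (D2 g x v w) <= L * nrm v * nrm w].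

(* sum over a partition k = s_0 < s_1 < ... < s_m < s_{m+1} = l, where
   t = [:: s_1; ...; s_m] are the inner points *)
Definition pvar_sum (d : nat) (p : R) (w : nat -> 'rV[R]_d) (k l : nat)
  (t : seq nat) : R :=
  \sum_(ab <- zip (k :: t) (rcons t l)) (l1norm (w ab.2 - w ab.1)) `^ p.

Definition pvar (d : nat) (p : R) (w : nat -> 'rV[R]_d) (k l : nat) : R :=
  (sup [set z | exists t : seq nat,
          path ltn k (rcons t l) /\ z = pvar_sum p w k l t]) `^ (1 / p).

Definition zetaN (N : nat) (s : R) : R :=
  \sum_(1 <= j < N.+1) (j%:R : R) `^ (- s).

Definition CpN (p : R) (N : nat) : R := 2 `^ (2 / p) * zetaN N (2 / p).

Definition cpN (p : R) (N : nat) : R :=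
  (4 * expR 2) `^ p * (4 `^ (p - 1) * (CpN p N) `^ p + 1).

End Defs.

(* Main.v *)
(* A control is a nonnegative superadditive function of intervals; the p-th
   powers of the p-variations of [w], [wt] and [w - wt], scaled by [L ^ p], give
   controls [om] (for [w] and [wt] together) and [et].  If the defect
   [Xi s t - Xi s u - Xi u t] of a two-parameter map is at most [chi(s,t)^(2/p)]
   for a control [chi], then deleting partition points one by one, each time at
   the smallest gap, bounds the distance of [Xi k l] to the sum of the
   [Xi j j.+1] by [CpN p N * chi(k,l)^(2/p)].

   On an interval where [4 * CpN p N * om^(1/p) <= 1], induction on the length
   of subintervals first bounds the increments of [x] and [xt] by
   [2 * om^(1/p)].  With [S] a bound of [|x - xt|] on the interval and
   [ka = S^p * om + et], the four-point estimate for C^2 maps bounds the defect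
   of the germ of [x - xt] by a multiple of [(ka * om)^(1/p)], and the geometric
   mean of two controls is a control; so the increments of [x - xt] are at most
   [4 * ka^(1/p)].  Absorbing [S] shows that [|x - xt| + 8 * et(0,N)^(1/p)] at
   most doubles on such an interval.  A single step, however large, costs a
   factor [9 / 8 + om^(1/p)]; cutting [0, N] greedily into small intervals
   followed by single steps and multiplying the factors gives the exponential,
   since [cpN p N * om] is large on each interval so obtained. *)
Require Import Defs.
From HB Require Import structures.
From mathcomp Require Import all_boot all_order all_algebra.
From mathcomp Require Import all_classical all_reals all_analysis.
From mathcomp Require Import zify lra ring.
Import Order.TTheory GRing.Theory Num.Theory.
Import numFieldNormedType.Exports.
Local Open Scope ring_scope.

Set Implicit Arguments.
Unset Strict Implicit.
Unset Printing Implicit Defensive.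

(** * Real powers with exponents [p] and [1 / p] *)

Section Powers.
Variable R : realType.
Implicit Types a b p : R.

Lemma powR_le a b p : 0 <= p -> 0 <= a -> a <= b -> a `^ p <= b `^ p.
Proof.
move=> p0 a0 ab; apply: ge0_ler_powR => //; rewrite nnegrE //.
exact: le_trans ab.
Qed.

Lemma powRK a p : 0 <= a -> 0 < p -> (a `^ p) `^ (1 / p) = a.
Proof. by move=> a0 p0; rewrite -powRrM div1r divff ?gt_eqF// powRr1. Qed.

Lemma rootRK a p : 0 <= a -> 0 < p -> (a `^ (1 / p)) `^ p = a.
Proof. by move=> a0 p0; rewrite -powRrM div1r mulVf ?gt_eqF// powRr1. Qed.

(** Write each p-th power as the base times its power [p - 1]; since [p - 1 >= 0], that second
    factor only grows when [a] or [b] is replaced by [a + b]. *)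
Lemma powR_superadd a b p : 0 <= a -> 0 <= b -> 1 <= p ->
  a `^ p + b `^ p <= (a + b) `^ p.
Proof.
move=> a0 b0 p1; have p0 : 0 < p by lra.
rewrite -(mulr_powRB1 a0 p0) -(mulr_powRB1 b0 p0).
rewrite -(mulr_powRB1 (addr_ge0 a0 b0) p0) mulrDl.
by apply: lerD; apply: ler_wpM2l => //; apply: powR_le; lra.
Qed.

Lemma rootR_subadd a b p : 0 <= a -> 0 <= b -> 1 <= p ->
  (a + b) `^ (1 / p) <= a `^ (1 / p) + b `^ (1 / p).
Proof.
move=> a0 b0 p1; have p0 : 0 < p by lra.
rewrite -[leRHS](@powRK _ p) ?addr_ge0 ?powR_ge0//.
apply: powR_le; [by rewrite divr_ge0 ?ltW|exact: addr_ge0|].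
have := powR_superadd (powR_ge0 a (1 / p)) (powR_ge0 b (1 / p)) p1.
by rewrite !rootRK.
Qed.

Lemma le_rootR a b p : 0 < p -> 0 <= a -> a `^ p <= b -> a <= b `^ (1 / p).
Proof.
move=> p0 a0 ab; rewrite -(powRK a0 p0); apply: powR_le => //.
  by rewrite divr_ge0 ?ltW.
exact: powR_ge0.
Qed.

End Powers.

(** * Controls: superadditive functions of intervals *)

Section Controls.
Variable R : realType.

Definition control (chi : nat -> nat -> R) : Prop :=
  (forall s t, 0 <= chi s t) /\
  (forall s u t, (s <= u)%N -> (u <= t)%N -> chi s u + chi u t <= chi s t).

Lemma control_mono chi s s' t' t : control chi ->
  (s <= s')%N -> (s' <= t')%N -> (t' <= t)%N -> chi s' t' <= chi s t.
Proof.
move=> [chi0 chiD] ss' s't' t't.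
have := chiD _ _ _ ss' (leq_trans s't' t't).
have := chiD _ _ _ s't' t't.
by have := chi0 s s'; have := chi0 t' t; lra.
Qed.

Lemma control_scale (a : R) chi : 0 <= a -> control chi ->
  control (fun s t => a * chi s t).
Proof.
move=> a0 [chi0 chiD]; split=> [s t|s u t su ut]; first exact: mulr_ge0.
by rewrite -mulrDr ler_wpM2l ?chiD.
Qed.

Lemma control_add chi1 chi2 : control chi1 -> control chi2 ->
  control (fun s t => chi1 s t + chi2 s t).
Proof.
move=> [c10 c1D] [c20 c2D]; split=> [s t|s u t su ut]; first exact: addr_ge0.
by rewrite addrACA lerD ?c1D ?c2D.
Qed.

(* Cauchy-Schwarz in the plane *)
Lemma control_geometric_mean chi1 chi2 : control chi1 -> control chi2 ->
  control (fun s t => Num.sqrt (chi1 s t * chi2 s t)).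
Proof.
move=> [c10 c1D] [c20 c2D]; split=> [s t|s u t su ut]; first exact: sqrtr_ge0.
have := c1D _ _ _ su ut; have := c2D _ _ _ su ut.
rewrite !sqrtrM//.
have q1 := sqrtr_ge0 (chi1 s u); have q2 := sqrtr_ge0 (chi1 u t).
have q3 := sqrtr_ge0 (chi2 s u); have q4 := sqrtr_ge0 (chi2 u t).
have q5 := sqrtr_ge0 (chi1 s t); have q6 := sqrtr_ge0 (chi2 s t).
rewrite -{1}(sqr_sqrtr (c20 s u)) -{1}(sqr_sqrtr (c20 u t)).
rewrite -{1}(sqr_sqrtr (c20 s t)).
rewrite -{1}(sqr_sqrtr (c10 s u)) -{1}(sqr_sqrtr (c10 u t)).
rewrite -{1}(sqr_sqrtr (c10 s t)).
move: q1 q2 q3 q4 q5 q6; move: (Num.sqrt (chi1 s u)) (Num.sqrt (chi1 u t)).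
move: (Num.sqrt (chi2 s u)) (Num.sqrt (chi2 u t)) (Num.sqrt (chi1 s t))
  (Num.sqrt (chi2 s t)).
move=> c e A B a b a0 b0 c0 e0 A0 B0 h1 h2.
rewrite -(@ler_pXn2r _ 2) ?nnegrE ?addr_ge0 ?mulr_ge0//.
rewrite exprMn; apply: (le_trans _ (ler_pM _ _ h2 h1)); rewrite ?addr_ge0 ?sqr_ge0//.
by rewrite -subr_ge0; have := sqr_ge0 (a * e - b * c); lra.
Qed.

(** The intervals [[tau i, tau i.+2]] form two chains of adjacent ones, for even and for odd [i].
    Keeping the end terms of both chains closes the induction: the shorter one joins the new
    interval by superadditivity. *)
Lemma control_sum2 chi (tau : nat -> nat) m : control chi ->
  {homo tau : i j / (i <= j)%N} ->
  \sum_(i < m) chi (tau i) (tau i.+2) <=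
  chi (tau 0%N) (tau m) + chi (tau 0%N) (tau m.+1).
Proof.
move=> [chi0 chiD] tauD; elim: m => [|m IH]; first by rewrite big_ord0 addr_ge0.
rewrite big_ord_recr /=.
have := chiD (tau 0%N) (tau m) (tau m.+2) (tauD _ _ (leq0n _))
  (tauD _ _ (leq_trans (leqnSn _) (leqnSn _))).
by move: IH; lra.
Qed.

(** Averaging: if all [m.+1] double gaps exceeded this bound, their sum would contradict
    [control_sum2]. *)
Lemma control_small_gap chi (tau : nat -> nat) m : control chi ->
  {homo tau : i j / (i <= j)%N} ->
  exists2 i, (i <= m)%N &
    chi (tau i) (tau i.+2) <= 2 / m.+1%:R * chi (tau 0%N) (tau m.+2).
Proof.
move=> cchi tauD; apply: contrapT => H.
have m0 : 0 < m.+1%:R :> R by rewrite ltr0n.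
suff : 2 * chi (tau 0%N) (tau m.+2) < 2 * chi (tau 0%N) (tau m.+2) by rewrite ltxx.
have : \sum_(i < m.+1) (2 / m.+1%:R * chi (tau 0%N) (tau m.+2)) <
    \sum_(i < m.+1) chi (tau i) (tau i.+2).
  apply: ltr_sum; first by apply/hasP; exists ord0; rewrite ?mem_index_enum.
  move=> i _; rewrite ltNge; apply/negP => h; apply: H; exists i => //.
  by rewrite -ltnS.
rewrite sumr_const card_ord -[_ *+ m.+1]mulr_natl mulrA
  [_ * (2 / _)]mulrC divfK ?gt_eqF//.
move=> /lt_le_trans; apply; apply: le_trans (control_sum2 m.+1 cchi tauD) _.
have := control_mono cchi (leqnn (tau 0%N)) (tauD 0%N m.+1 (leq0n _))
  (tauD _ _ (leqnSn m.+1)).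
by lra.
Qed.

End Controls.

(** * An arbitrary norm on the state space *)

Section Norms.
Variables (R : realType) (n : nat) (nrm : 'rV[R]_n -> R).
Hypothesis nrmP : is_norm nrm.

Lemma nrmZ a x : nrm (a *: x) = `|a| * nrm x. Proof. by case: nrmP. Qed.
Lemma nrmD x y : nrm (x + y) <= nrm x + nrm y. Proof. by case: nrmP. Qed.
Lemma nrm0 : nrm 0 = 0.
Proof. by rewrite -(scale0r (0 : 'rV[R]_n)) nrmZ normr0 mul0r. Qed.
Lemma nrmN x : nrm (- x) = nrm x.
Proof. by rewrite -scaleN1r nrmZ normrN1 mul1r. Qed.
Lemma nrm_ge0 x : 0 <= nrm x.
Proof. by have := nrmD x (- x); rewrite nrmN subrr nrm0; lra. Qed.
Lemma nrmB x y : nrm (x - y) <= nrm x + nrm y.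
Proof. by rewrite -(nrmN y); exact: nrmD. Qed.

(** Measuring the driver in the l1 norm lets a bound uniform in [mu] come out without a factor
    [d]. *)
Lemma nrm_sum_scale d (a : 'rV[R]_d) (g : 'I_d -> 'rV[R]_n) M :
  (forall mu, nrm (g mu) <= M) ->
  nrm (\sum_(mu < d) a 0 mu *: g mu) <= M * l1norm a.
Proof.
move=> gM; rewrite /l1norm mulr_sumr.
elim/big_ind2: _ => [|x1 x2 y1 y2 h1 h2|mu _]; first by rewrite nrm0.
- by apply: le_trans (nrmD _ _) _; exact: lerD.
- by rewrite nrmZ mulrC; exact: ler_wpM2r.
Qed.

(** Differentiability is expressed in the matrix norm; this half of the equivalence of norms
    transfers its remainder estimates to [nrm]. *)
Lemma nrm_le_mx_norm : exists2 K, 0 <= K & forall x, nrm x <= K * `|x|.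
Proof.
exists (\sum_(j < n) nrm 'e_j); first by apply: sumr_ge0 => j _; exact: nrm_ge0.
move=> x; rewrite {1}(row_sum_delta x) mulr_suml.
elim/big_ind2: _ => [|x1 x2 y1 y2 h1 h2|j _]; first by rewrite nrm0.
- by apply: le_trans (nrmD _ _) _; exact: lerD.
- rewrite nrmZ mulrC; apply: ler_wpM2l; first exact: nrm_ge0.
  rewrite [leRHS]mx_normrE.
  exact: (le_bigmax _ (fun ij => `|x ij.1 ij.2|) (0, j)).
Qed.

End Norms.

(** * The discrete sewing estimate *)

Section Sewing.

(** [bump i.+1] enumerates the indices other than [i.+1], so deleting that point changes the sum by
    exactly one defect. *)
Lemma sum_remove_point (V : zmodType) (F : nat -> nat -> V) m i : (i <= m)%N ->
  \sum_(0 <= j < m.+2) F j j.+1 =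
  \sum_(0 <= j < m.+1) F (bump i.+1 j) (bump i.+1 j.+1)
  - (F i i.+2 - F i i.+1 - F i.+1 i.+2).
Proof.
move=> im.
rewrite (@big_cat_nat _ _ _ i 0%N m.+2)//=; last by lia.
rewrite (@big_cat_nat _ _ _ i 0%N m.+1)//=; last by lia.
rewrite (@big_ltn _ _ _ i m.+2); last by lia.
rewrite (@big_ltn _ _ _ i.+1 m.+2); last by lia.
rewrite (@big_ltn _ _ _ i m.+1); last by lia.
rewrite big_add1 /=.
under [in RHS]eq_big_nat => j /andP[_ ji].
  have -> : bump i.+1 j = j by rewrite /bump; lia.
  have -> : bump i.+1 j.+1 = j.+1 by rewrite /bump; lia.
  over.
under [X in _ = _ + (_ + X) - _]eq_big_nat => j /andP[ij _].
  have -> : bump i.+1 j = j.+1 by rewrite /bump; lia.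
  have -> : bump i.+1 j.+1 = j.+2 by rewrite /bump; lia.
  over.
have -> : bump i.+1 i = i by rewrite /bump; lia.
have -> : bump i.+1 i.+1 = i.+2 by rewrite /bump; lia.
move: (\sum_(0 <= j < i) _) (\sum_(i.+1 <= j < m.+1) _)
  (F i i.+2) (F i i.+1) (F i.+1 i.+2).
move=> a b c e h; rewrite -!addrA; congr (a + _).
by rewrite !opprD !opprK [b + (- c + _)]addrCA addNKr addrA addrC.
Qed.

Variables (R : realType) (n : nat) (nrm : 'rV[R]_n -> R).
Hypothesis nrmP : is_norm nrm.
Variables (Xi : nat -> nat -> 'rV[R]_n) (chi : nat -> nat -> R) (theta M : R).
Variables (lo hi : nat).
Hypotheses (chiP : control chi) (theta0 : 0 <= theta) (M0 : 0 <= M).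
Hypothesis XiP : forall s u t, (lo <= s)%N -> (s < u)%N -> (u < t)%N ->
  (t <= hi)%N -> nrm (Xi s t - Xi s u - Xi u t) <= M * chi s t `^ theta.

(** With [m.+1] inner points, deleting the one in the smallest double gap costs at most
    [M * (2 / m.+1)^theta * chi^theta]. The costs add up to the partial zeta sum, which is empty
    once no inner point is left. *)
Lemma sewing_partition m (tau : nat -> nat) : {homo tau : i j / (i < j)%N} ->
  (lo <= tau 0)%N -> (tau m.+1 <= hi)%N ->
  nrm (\sum_(0 <= i < m.+1) Xi (tau i) (tau i.+1) - Xi (tau 0%N) (tau m.+1)) <=
  M * (2 `^ theta * zetaN m theta) * chi (tau 0%N) (tau m.+1) `^ theta.
Proof.
elim: m tau => [|m IH] tau tauS lo0 him.
  rewrite big_nat1 subrr (nrm0 nrmP) /zetaN big_geq// !mulr0 mul0r; lra.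
have tauD : {homo tau : i j / (i <= j)%N}.
  by move=> i j; rewrite leq_eqVlt => /predU1P[->//|/tauS/ltnW].
have [i im gap] := control_small_gap m chiP tauD.
rewrite (sum_remove_point (fun a b => Xi (tau a) (tau b)) im).
have b0 : bump i.+1 0 = 0%N by rewrite /bump; lia.
have bm : bump i.+1 m.+1 = m.+2 by rewrite /bump; lia.
have := IH (tau \o bump i.+1); rewrite /= b0 bm => IH'.
rewrite addrAC; apply: le_trans (nrmB nrmP _ _) _.
apply: le_trans (lerD (IH' _ lo0 him) (XiP _ _ _ _)) _.
- by move=> a b ab /=; apply: tauS; rewrite /bump; lia.
- by apply: leq_trans lo0 _; exact: tauD.
- exact: tauS.
- exact: tauS.
- by apply: leq_trans him; exact: tauD.
rewrite -!mulrA -mulrDr; apply: ler_wpM2l => //.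
have chi0 := chiP.1 (tau 0%N) (tau m.+2).
have gap' := powR_le theta0 (chiP.1 _ _) gap.
have m0 : 0 <= m.+1%:R^-1 :> R by rewrite invr_ge0 ler0n.
rewrite !powRM ?mulr_ge0// in gap'.
rewrite /zetaN [in leRHS]big_nat_recr//=.
have Xm : m.+1%:R^-1 `^ theta = m.+1%:R `^ (- theta) :> R.
  by rewrite -powR_inv1 ?ler0n// -powRrM mulN1r.
by rewrite Xm in gap'; lra.
Qed.

Lemma le_zetaN m N (s : R) : (m <= N)%N -> zetaN m s <= zetaN N s.
Proof.
move=> mN; rewrite /zetaN (@big_cat_nat _ _ _ m.+1 1%N N.+1)//= lerDl.
by apply: sumr_ge0 => j _; exact: powR_ge0.
Qed.

(** The finest partition of [[k, l]] has [l - k - 1] inner points. For [theta = 2 / p] the constant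
    in parentheses is [CpN p N]. *)
Lemma sewing k l N : (lo <= k)%N -> (k < l)%N -> (l <= hi)%N ->
  (l - k <= N)%N ->
  nrm (\sum_(k <= j < l) Xi j j.+1 - Xi k l) <=
  M * (2 `^ theta * zetaN N theta) * chi k l `^ theta.
Proof.
move=> lok kl lhi lkN.
have := @sewing_partition (l - k).-1 (addn k).
have -> : ((l - k).-1.+1 = l - k)%N by lia.
rewrite addn0 subnKC ?(ltnW kl)// => /(_ _ lok lhi) H.
rewrite -{1}[k]add0n big_addn.
under eq_bigr do rewrite addnC -addnS.
apply: le_trans (H _) _; first by move=> i j ij; lia.
apply: ler_wpM2r; first exact: powR_ge0.
apply: ler_wpM2l => //; apply: ler_wpM2l; first exact: powR_ge0.
by apply: le_zetaN; lia.
Qed.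

End Sewing.

(** * The p-variation as a control *)

Section PVariation.
Variables (R : realType) (d : nat) (p : R) (w : nat -> 'rV[R]_d).
Hypothesis p1 : 1 <= p.

Let p0 : 0 < p. Proof. exact: lt_le_trans p1. Qed.

Definition pvar_sums k l : set R :=
  [set z | exists t : seq nat,
    path ltn k (rcons t l) /\ z = pvar_sum p w k l t]%classic.

(** The p-th power of [pvar]: it is this power, without the root, that is superadditive. *)
Definition pvarp k l : R := sup (pvar_sums k l).

Lemma pvar_sum_ge0 k l t : 0 <= pvar_sum p w k l t.
Proof. by apply: sumr_ge0 => ab _; exact: powR_ge0. Qed.

Lemma pvar_sum_cons k l b t : pvar_sum p w k l (b :: t) =
  l1norm (w b - w k) `^ p + pvar_sum p w b l t.
Proof. by rewrite /pvar_sum /= big_cons. Qed.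

Lemma pvar_sum_cat k m l s t : pvar_sum p w k l (s ++ m :: t) =
  pvar_sum p w k m s + pvar_sum p w m l t.
Proof.
elim: s k => [|b s IH] k /=; last by rewrite !pvar_sum_cons IH addrA.
by rewrite pvar_sum_cons; congr (_ + _); rewrite /pvar_sum /= big_seq1.
Qed.

(** Each index [a] starts at most one segment of a partition, and the term of that segment is one of
    the summands of [G a]. *)
Lemma has_ubound_pvar_sums k l : has_ubound (pvar_sums k l).
Proof.
pose G a : R := \sum_(0 <= b < l.+1) l1norm (w b - w a) `^ p.
have G_ge a b : (b <= l)%N -> l1norm (w b - w a) `^ p <= G a.
  move=> bl; rewrite /G (bigD1_seq b) ?mem_index_iota ?iota_uniq//=.
  by rewrite lerDl; apply: sumr_ge0 => j _; exact: powR_ge0.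
exists (\sum_(k <= a < l) G a) => _ [t [+ ->]].
elim: t k => [|b t IH] k /= /andP[kb pt].
  rewrite /pvar_sum /= big_seq1 /= big_ltn//; apply: le_trans (G_ge k l (leqnn l)) _.
  by rewrite lerDl; apply: sumr_ge0 => a _; apply: sumr_ge0 => b _; exact: powR_ge0.
have bl : (b < l)%N.
  have := pt; rewrite (path_sortedE ltn_trans) => /andP[/allP/(_ l)].
  by rewrite mem_rcons mem_head => /(_ isT).
rewrite pvar_sum_cons big_ltn ?(ltn_trans kb)//.
apply: lerD; first exact/G_ge/ltnW.
apply: le_trans (IH _ pt) _; rewrite (@big_cat_nat _ _ _ b k.+1 l)//= ?(ltnW bl)//.
by rewrite lerDr; apply: sumr_ge0 => a _; apply: sumr_ge0 => c _; exact: powR_ge0.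
Qed.

Lemma pvar_sums_nonempty k l : (k < l)%N -> (pvar_sums k l !=set0)%classic.
Proof. by move=> kl; exists (pvar_sum p w k l [::]); exists [::]; rewrite /= kl. Qed.

(** No strictly increasing sequence leads from [k] to [k], so [sup] takes its default value 0. *)
Lemma pvarp_diag k : pvarp k k = 0.
Proof.
apply: sup_out => -[[_ [t [pt _]]] _]; move: pt.
rewrite (path_sortedE ltn_trans) => /andP[/allP/(_ k)].
by rewrite mem_rcons mem_head ltnn => /(_ isT).
Qed.

Lemma pvarp_ge0 k l : 0 <= pvarp k l.
Proof.
rewrite /pvarp; have [->|/set0P[z zA]] := eqVneq (pvar_sums k l) set0.
  by rewrite sup0.
apply: le_trans (ub_le_sup (has_ubound_pvar_sums k l) zA).
by case: zA => t [_ ->]; exact: pvar_sum_ge0.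
Qed.

(** Partitions of [[s, u]] and [[u, t]] join at [u] to one of [[s, t]] whose sum is the total of
    theirs; the two suprema are then taken one after the other. *)
Lemma pvarp_control : control pvarp.
Proof.
split=> [|s u t]; first exact: pvarp_ge0.
rewrite leq_eqVlt => /predU1P[<- _|su]; first by rewrite pvarp_diag add0r.
rewrite leq_eqVlt => /predU1P[<-|ut]; first by rewrite pvarp_diag addr0.
rewrite -lerBrDr; apply: ge_sup (pvar_sums_nonempty su) _ => _ [a [pa ->]].
rewrite lerBrDr addrC -lerBrDr.
apply: ge_sup (pvar_sums_nonempty ut) _ => _ [b [pb ->]].
rewrite lerBrDr addrC -pvar_sum_cat; apply: (ub_le_sup (has_ubound_pvar_sums s t)).
exists (a ++ u :: b); split=> //.
by rewrite rcons_cat -cat_rcons cat_path pa last_rcons.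
Qed.

Lemma l1norm_ge0 (a : 'rV[R]_d) : 0 <= l1norm a.
Proof. by apply: sumr_ge0 => mu _; exact: normr_ge0. Qed.

Lemma l1norm_le_pvarp k l : (k <= l)%N ->
  l1norm (w l - w k) `^ p <= pvarp k l.
Proof.
rewrite leq_eqVlt => /predU1P[<-|kl].
  rewrite pvarp_diag subrr /l1norm big1 ?powR0 ?gt_eqF// => mu _.
  by rewrite mxE normr0.
apply: (ub_le_sup (has_ubound_pvar_sums k l)); exists [::].
by rewrite /= kl /pvar_sum /= big_seq1.
Qed.

Lemma pvar_powR k l : (pvar p w k l) `^ p = pvarp k l.
Proof. by rewrite /pvar rootRK ?pvarp_ge0. Qed.

End PVariation.

(** * Mean value and four-point inequalities *)

Section MeanValue.
Variables (R : realType) (n : nat) (nrm : 'rV[R]_n -> R).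
Hypothesis nrmP : is_norm nrm.

(* With [M + e] in place of [M], the set of [t] where the bound holds contains
   its supremum [s], and differentiability at [s] pushes the bound beyond [s]
   unless [s = 1]. *)
Lemma mean_value_inequality (g g' : R -> 'rV[R]_n) (M : R) :
  (forall t e, 0 < e -> exists2 r, 0 < r &
     forall h, `|h| < r -> nrm (g (t + h) - g t - h *: g' t) <= e * `|h|) ->
  (forall t, 0 <= t <= 1 -> nrm (g' t) <= M) ->
  nrm (g 1 - g 0) <= M.
Proof.
move=> dg gM; apply/ler_addgt0Pr => e e0.
pose A := [set t | 0 <= t <= 1 /\ nrm (g t - g 0) <= (M + e) * t]%classic.
have A0 : A 0 by split; rewrite ?lexx ?ler01// subrr (nrm0 nrmP) mulr0.
have Aub : has_ubound A by exists 1 => t [/andP[]].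
have supA : has_sup A by split=> //; exists 0.
pose s := sup A.
have s0 : 0 <= s by exact: ub_le_sup.
have s1 : s <= 1 by apply: ge_sup; [exists 0|move=> t [/andP[]]].
have s01 : 0 <= s <= 1 by rewrite s0.
have [r r0 gr] := dg s e e0.
have near_s h : `|h| < r -> nrm (g (s + h) - g s) <= (M + e) * `|h|.
  move=> /gr ghr; rewrite -(subrK (h *: g' s) (g (s + h) - g s)).
  apply: le_trans (nrmD nrmP _ _) _; rewrite (nrmZ nrmP).
  by have := ler_wpM2l (normr_ge0 h) (gM s s01); lra.
have As : A s.
  split=> //; have [a [/andP[a0 a1] Aa] sra] := sup_adherent r0 supA.
  have sa : a <= s by apply: ub_le_sup => //; split=> //; rewrite a0.
  have /near_s : `|a - s| < r by rewrite ltr_norml; move: sra; rewrite -/s; lra.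
  rewrite subrKC ler0_norm ?subr_le0// => gas.
  rewrite -(subrKA (g a)) -[g s - g a]opprB.
  apply: le_trans (nrmD nrmP _ _) _; rewrite (nrmN nrmP).
  by lra.
have [s1'|s1'] := ltP s 1; last first.
  have <- : s = 1 by apply/eqP; rewrite eq_le s1.
  by case: As => _; rewrite {2}(_ : s = 1) ?mulr1//; apply/eqP; rewrite eq_le s1.
pose h := Num.min (r / 2) (1 - s).
have h0 : 0 < h by rewrite lt_min; apply/andP; split; lra.
have hr : h <= r / 2 by rewrite ge_min lexx.
have hs : h <= 1 - s by rewrite ge_min lexx orbT.
have /near_s : `|h| < r by rewrite gtr0_norm//; lra.
rewrite (gtr0_norm h0) => gsh.
suff : s + h <= s by lra.
apply: ub_le_sup => //; split; first by lra.
case: As => _ As; rewrite -(subrKA (g s)).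
by apply: le_trans (nrmD nrmP _ _) _; lra.
Qed.

(** Restricts Frechet differentiability to a line, in the form that [mean_value_inequality] takes as
    its hypothesis. *)
Lemma differentiable_along (f : 'rV[R]_n -> 'rV[R]_n) (a b : 'rV[R]_n) (t e : R) :
  (forall x, differentiable f x) -> 0 < e -> exists2 r, 0 < r &
    forall h, `|h| < r ->
      nrm (f (a + (t + h) *: b) - f (a + t *: b) - h *: 'd f (a + t *: b) b)
      <= e * `|h|.
Proof.
move=> df e0; have [K K0 nK] := nrm_le_mx_norm nrmP.
set P := a + t *: b.
have KB0 : 0 < (K + 1) * (`|b| + 1) by rewrite mulr_gt0 ?ltr_wpDl.
(* This tolerance compensates for [K] from the change of norm and for the length of [b]; the added
   ones keep the denominators positive when these vanish. *)
have /eqaddoP/(_ (e / ((K + 1) * (`|b| + 1)))) := diff_locally (df P).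
rewrite divr_gt0// => /(_ isT)/nbhs_norm0P[/= r r0 fr].
exists (r / (`|b| + 1)); first by rewrite divr_gt0 ?ltr_wpDl.
move=> h; rewrite ltr_pdivlMr ?ltr_wpDl// => hr.
have hb : `|h *: b| <= `|h| * (`|b| + 1).
  by rewrite normrZ ler_wpM2l// lerDl.
have := fr (h *: b) (le_lt_trans hb hr).
rewrite /= !fctE /= linearZ /= => {}fr.
apply: le_trans (nK _) _.
have -> : f (a + (t + h) *: b) - f P - h *: 'd f P b =
    f (h *: b + P) - (f P + h *: 'd f P b).
  by rewrite opprD addrA /P scalerDl addrA [h *: b + _]addrC.
apply: le_trans (ler_wpM2l K0 fr) _.
apply: (@le_trans _ _ ((K + 1) * (e / ((K + 1) * (`|b| + 1)) * (`|h| * (`|b| + 1))))).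
  apply: ler_pM => //; first by rewrite mulr_ge0// divr_ge0// ltW.
    by rewrite lerDl.
  by apply: ler_wpM2l => //; rewrite divr_ge0// ltW.
rewrite le_eqVlt; apply/orP; left; apply/eqP; field.
by rewrite !gt_eqF ?ltr_wpDl.
Qed.

Lemma nrm_diff_le (f : 'rV[R]_n -> 'rV[R]_n) (a b : 'rV[R]_n) M :
  (forall x, differentiable f x) ->
  (forall x, nrm ('d f x (b - a)) <= M) -> nrm (f b - f a) <= M.
Proof.
move=> df fM.
have := @mean_value_inequality (fun t => f (a + t *: (b - a)))
  (fun t => 'd f (a + t *: (b - a)) (b - a)) M.
rewrite scale1r scale0r addr0 subrKC; apply=> // t e e0.
exact: differentiable_along.
Qed.

Variables (f : 'rV[R]_n -> 'rV[R]_n) (L : R).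
Hypotheses (L0 : 0 <= L) (fP : C2b_le nrm f L).

Lemma C2b_lipschitz a b : nrm (f b - f a) <= L * nrm (b - a).
Proof. by case: fP => -[df _ _] _ fL _; exact: nrm_diff_le. Qed.

(* Apply the mean value inequality to
   [t |-> f (xt_u + t (x_u - xt_u)) - f (xt_s + t (x_s - xt_s))]. *)
Lemma C2b_four_points xs xu xts xtu D :
  nrm (xu - xs) <= D -> nrm (xtu - xts) <= D ->
  nrm ((f xu - f xtu) - (f xs - f xts)) <=
  L * nrm ((xu - xtu) - (xs - xts)) + L * D * nrm (xs - xts).
Proof.
move=> xD xtD; case: (fP) => -[df d2f _] _ fL f2L.
set yu := xu - xtu; set ys := xs - xts.
pose M := L * nrm (yu - ys) + L * D * nrm ys.
have := @mean_value_inequality (fun t => f (xtu + t *: yu) - f (xts + t *: ys))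
  (fun t => 'd f (xtu + t *: yu) yu - 'd f (xts + t *: ys) ys) M.
rewrite !scale1r !scale0r !addr0 !subrKC => mvt.
have -> : f xu - f xtu - (f xs - f xts) = f xu - f xs - (f xtu - f xts).
  by rewrite !opprD !opprK addrACA.
have rearrange (a b a' b' c c' : 'rV[R]_n) (h : R) :
    a' - b' - (c - c') - h *: (a - b) = (a' - c - h *: a) - (b' - c' - h *: b).
  by apply/rowP => i; rewrite !mxE; ring.
apply: mvt => [t e e0|t /andP[t0 t1]].
  have e20 : 0 < e / 2 by lra.
  have [r1 r10 f1] := differentiable_along xtu yu t df e20.
  have [r2 r20 f2] := differentiable_along xts ys t df e20.
  exists (Num.min r1 r2) => [|h]; first by rewrite lt_min r10.
  rewrite lt_min => /andP[/f1 {}f1 /f2 {}f2].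
  rewrite rearrange; apply: le_trans (nrmB nrmP _ _) _.
  by apply: le_trans (lerD f1 f2) _; lra.
set Pu := xtu + t *: yu; set Ps := xts + t *: ys.
(* Change first the direction at the point [Pu], then the point in the direction [ys]. The second
   change is controlled by the second derivative, since [Pu - Ps] is a convex combination of two
   vectors of norm at most [D]. *)
have -> : 'd f Pu yu - 'd f Ps ys =
    'd f Pu (yu - ys) + ('d f Pu ys - 'd f Ps ys).
  have dB := linearB ('d f Pu) yu ys.
  rewrite -[LHS](subrKA ('d f Pu ys)); congr (_ + _); exact: esym dB.
apply: le_trans (nrmD nrmP _ _) _; apply: lerD => //.
have PD : nrm (Pu - Ps) <= D.
  have -> : Pu - Ps = (1 - t) *: (xtu - xts) + t *: (xu - xs).
    by apply/rowP => i; rewrite /Pu /Ps /yu /ys !mxE; ring.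
  apply: le_trans (nrmD nrmP _ _) _; rewrite !(nrmZ nrmP) !ger0_norm ?subr_ge0//.
  by have := ler_wpM2l t0 xD; have := @ler_wpM2l _ (1 - t) _ _ _ xtD; lra.
apply: (@nrm_diff_le (fun y => 'd f y ys)) => // x.
apply: le_trans (f2L _ _ _) _.
by rewrite mulrAC; apply: ler_wpM2r; rewrite ?(nrm_ge0 nrmP)// ler_wpM2l.
Qed.

End MeanValue.

(** * Left-point germs and their defects *)

Section Germs.
Variables (R : realType) (n d : nat) (nrm : 'rV[R]_n -> R).
Hypothesis nrmP : is_norm nrm.

(** The left-point approximation of the Young integral of [F] against [v] over [[s, t]]. *)
Definition germ (F : 'I_d -> nat -> 'rV[R]_n) (v : nat -> 'rV[R]_d) s t :=
  \sum_(mu < d) (v t - v s) 0 mu *: F mu s.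

Lemma nrm_germ F v s t M : (forall mu, nrm (F mu s) <= M) ->
  nrm (germ F v s t) <= M * l1norm (v t - v s).
Proof. exact: nrm_sum_scale. Qed.

(** As [v] has additive increments, the defect is a product of the increments of [F] over [[s, u]]
    and of [v] over [[u, t]]. Two factors of order [1 / p] yield the sewing exponent [2 / p]. *)
Lemma nrm_germ_defect F v s u t M :
  (forall mu, nrm (F mu u - F mu s) <= M) ->
  nrm (germ F v s t - germ F v s u - germ F v u t) <= M * l1norm (v t - v u).
Proof.
move=> FM.
have -> : germ F v s t - germ F v s u - germ F v u t =
    - \sum_(mu < d) (v t - v u) 0 mu *: (F mu u - F mu s).
  rewrite /germ -!sumrB -sumrN; apply: eq_bigr => mu _.
  by apply/rowP => i; rewrite !mxE; ring.
by rewrite (nrmN nrmP); exact: nrm_sum_scale.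
Qed.

End Germs.

Lemma inner_interval_lt s s' u t' t :
  (s <= s' -> s' < u -> u < t' -> t' <= t -> u - s' < t - s)%N.
Proof. lia. Qed.

(** * Stability of the recursion in terms of abstract controls *)

Section Stability.
Variables (R : realType) (p : R) (N d n : nat) (nrm : 'rV[R]_n -> R).
Variables (f : 'I_d -> 'rV[R]_n -> 'rV[R]_n) (L : R).
Hypotheses (p1 : 1 <= p) (nrmP : is_norm nrm) (L0 : 0 < L).
Hypothesis fP : forall mu, C2b_le nrm (f mu) L.

Let C : R := CpN p N.
Hypothesis C2 : 2 <= C.

Let p0 : 0 < p. Proof. exact: lt_le_trans p1. Qed.
Let ip0 : 0 <= 1 / p. Proof. by rewrite divr_ge0 ?ltW. Qed.
Let ip20 : 0 <= 2 / p. Proof. by rewrite divr_ge0 ?ltW. Qed.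

Let C40 : 0 <= 4 * C. Proof. by rewrite mulr_ge0// (le_trans _ C2). Qed.

Lemma powR_2p (a : R) : a `^ (2 / p) = (a `^ (1 / p)) ^+ 2.
Proof. by rewrite -powR_mulrn ?powR_ge0// -powRrM mulrAC mul1r. Qed.

(** Turns the power [2 / p] of a geometric mean of controls into the power [1 / p] of their
    product. *)
Lemma sqrt_powR_2p (a : R) : 0 <= a -> Num.sqrt a `^ (2 / p) = a `^ (1 / p).
Proof.
move=> a0; rewrite -[2 / p]mulr1 mulrAC -mulrA powRrM.
by rewrite powR_mulrn ?sqrtr_ge0// sqr_sqrtr.
Qed.

Lemma control_root_mono chi s s' t' t : control chi ->
  (s <= s')%N -> (s' <= t')%N -> (t' <= t)%N ->
  chi s' t' `^ (1 / p) <= chi s t `^ (1 / p).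
Proof.
by move=> chiP ss st tt; apply: powR_le => //; [exact: chiP.1|exact: control_mono].
Qed.

Definition solves (x : nat -> 'rV[R]_n) (v : nat -> 'rV[R]_d) :=
  forall j, (j < N)%N ->
    x j.+1 = x j + germ (fun mu i => f mu (x i)) v j j.+1.

(** [L] is absorbed into the control, so the estimates below contain no [L]. *)
Definition dominated (v : nat -> 'rV[R]_d) (chi : nat -> nat -> R) :=
  forall s t, (s <= t)%N -> L * l1norm (v t - v s) <= chi s t `^ (1 / p).

(** Put [r = om(s,t)^(1/p)]. The defect involves only increments over shorter intervals, so the
    induction hypothesis and sewing put [x t - x s] within [2 * C * r^2 <= r / 2] of its germ, which
    is at most [r]. *)
Lemma solution_increment x v om k l : control om -> dominated v om ->
  solves x v -> (l <= N)%N -> 4 * C * om k l `^ (1 / p) <= 1 ->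
  forall s t, (k <= s)%N -> (s <= t)%N -> (t <= l)%N ->
  nrm (x t - x s) <= 2 * om s t `^ (1 / p).
Proof.
move=> omP vom xv lN small s t.
have [m] := ubnP (t - s); elim: m s t => // m IH s t tsm ks.
rewrite leq_eqVlt => /predU1P[<- _|st tl].
  by rewrite subrr (nrm0 nrmP) mulr_ge0 ?powR_ge0.
set Xi := germ (fun mu i => f mu (x i)) v.
have Xi_defect s' u t' : (s <= s')%N -> (s' < u)%N -> (u < t')%N -> (t' <= t)%N ->
    nrm (Xi s' t' - Xi s' u - Xi u t') <= 2 * om s' t' `^ (2 / p).
  move=> ss' s'u ut' t't.
  apply: le_trans (nrm_germ_defect nrmP (F := fun mu i => f mu (x i)) v t'
    (fun mu => C2b_lipschitz nrmP (fP mu) (x s') (x u))) _.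
  have us'm := leq_trans (inner_interval_lt ss' s'u ut' t't) (ltnSE tsm).
  have ul := leq_trans (ltnW ut') (leq_trans t't tl).
  have xu := IH _ _ us'm (leq_trans ks ss') (ltnW s'u) ul.
  have m1 := control_root_mono omP (leqnn s') (ltnW s'u) (ltnW ut').
  have m2 := control_root_mono omP (ltnW s'u) (ltnW ut') (leqnn t').
  rewrite mulrAC powR_2p expr2 mulrA mulrC.
  apply: ler_pM; rewrite ?(nrm_ge0 nrmP) ?mulr_ge0 ?l1norm_ge0 ?(ltW L0)//.
    by apply: le_trans xu _; rewrite ler_wpM2l.
  exact: le_trans (vom _ _ (ltnW ut')) m2.
have sum_Xi : \sum_(s <= j < t) Xi j j.+1 = x t - x s.
  apply: telescope_sumr_eq; first exact: ltnW.
  move=> j /andP[_ jt]; have jN := leq_trans jt (leq_trans tl lN).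
  by rewrite (xv j jN) [x j + _]addrC addrK.
have tsN := leq_trans (leq_subr s t) (leq_trans tl lN).
have := sewing nrmP (N := N) omP ip20 (ler0n R 2) Xi_defect (leqnn s) st (leqnn t).
rewrite sum_Xi -/(CpN p N) -/C => /(_ tsN) sew.
have Xi_st : nrm (Xi s t) <= om s t `^ (1 / p).
  apply: le_trans (nrm_germ nrmP (M := L) v t _) _; last exact: vom (ltnW st).
  by move=> mu; case: (fP mu).
have := control_root_mono omP ks (ltnW st) tl.
have r0 := powR_ge0 (om s t) (1 / p).
rewrite powR_2p in sew.
rewrite -(subrK (Xi s t) (x t - x s)); move: sew Xi_st r0.
have := nrmD nrmP (x t - x s - Xi s t) (Xi s t).
move: (om s t `^ (1 / p)) => r n1 n2 n3 r0 rle.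
have : 4 * C * r <= 1 by apply: le_trans small; exact: ler_wpM2l.
by nra.
Qed.

Variables (w wt : nat -> 'rV[R]_d) (x xt : nat -> 'rV[R]_n).
Variables om et : nat -> nat -> R.
Hypotheses (omP : control om) (etP : control et).
Hypotheses (w_om : dominated w om) (wt_om : dominated wt om).
Hypothesis dw_et : dominated (fun j => w j - wt j) et.
Hypotheses (xw : solves x w) (xtwt : solves xt wt).

Let y j := x j - xt j.
(** The germ of [y]: the difference of the vector fields is driven by [w], and the field along [xt]
    is driven by [w - wt]. *)
Let Xi s t :=
  germ (fun mu j => f mu (x j) - f mu (xt j)) w s t +
  germ (fun mu j => f mu (xt j)) (fun j => w j - wt j) s t.

Lemma diff_step j : (j < N)%N -> y j.+1 - y j = Xi j j.+1.
Proof.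
move=> jN; rewrite /y xw// xtwt// /Xi /germ -big_split /=.
rewrite opprD addrACA [LHS]addrAC subrr add0r -sumrB; apply: eq_bigr => mu _.
by apply/rowP => i; rewrite !mxE; ring.
Qed.

Lemma nrm_germ_diff s t S : (s <= t)%N -> nrm (y s) <= S ->
  nrm (Xi s t) <= S * om s t `^ (1 / p) + et s t `^ (1 / p).
Proof.
move=> st yS; apply: le_trans (nrmD nrmP _ _) _; apply: lerD.
  apply: le_trans (nrm_germ nrmP (M := L * nrm (y s)) w t _) _.
    by move=> mu; exact: (C2b_lipschitz nrmP (fP mu) (xt s) (x s)).
  rewrite mulrAC mulrC; apply: ler_pM => //; rewrite ?(nrm_ge0 nrmP)//.
    by rewrite mulr_ge0 ?l1norm_ge0 ?(ltW L0).
  exact: w_om.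
apply: le_trans (nrm_germ nrmP (M := L) (fun j => w j - wt j) t _) _;
  last exact: dw_et.
by move=> mu; case: (fP mu).
Qed.

(** Same induction as in [solution_increment]. With [K = ka(s,t)^(1/p)] and [r = om(s,t)^(1/p)],
    sewing costs [8 * C * K * r <= 2 * K], and both terms of the germ are at most [K], which makes 4
    in total. *)
Lemma diff_increment k l S : (l <= N)%N -> 4 * C * om k l `^ (1 / p) <= 1 ->
  0 <= S -> (forall j, (k <= j <= l)%N -> nrm (y j) <= S) ->
  forall s t, (k <= s)%N -> (s <= t)%N -> (t <= l)%N ->
  nrm (y t - y s) <= 4 * (S `^ p * om s t + et s t) `^ (1 / p).
Proof.
move=> lN small S0 yS s t.
pose ka s t := S `^ p * om s t + et s t.
have kaP : control ka.
  by apply: control_add => //; apply: control_scale => //; exact: powR_ge0.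
have om_ka a b : S * om a b `^ (1 / p) <= ka a b `^ (1 / p).
  rewrite -{1}(powRK S0 p0) -powRM ?powR_ge0 ?omP.1//.
  apply: powR_le; [by []|by rewrite mulr_ge0 ?powR_ge0 ?omP.1|].
  by rewrite /ka lerDl etP.1.
have et_ka a b : et a b `^ (1 / p) <= ka a b `^ (1 / p).
  apply: powR_le; [by []|exact: etP.1|].
  rewrite /ka lerDr.
  by rewrite mulr_ge0 ?powR_ge0 ?omP.1.
rewrite -/(ka s t).
have [m] := ubnP (t - s); elim: m s t => // m IH s t tsm ks.
rewrite leq_eqVlt => /predU1P[<- _|st tl].
  by rewrite subrr (nrm0 nrmP) mulr_ge0 ?powR_ge0.
pose chi a b := Num.sqrt (ka a b * om a b).
have chiE a b : chi a b `^ (2 / p) = ka a b `^ (1 / p) * om a b `^ (1 / p).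
  by rewrite sqrt_powR_2p ?mulr_ge0 ?kaP.1 ?omP.1// powRM ?kaP.1 ?omP.1.
have Xi_defect s' u t' : (s <= s')%N -> (s' < u)%N -> (u < t')%N -> (t' <= t)%N ->
    nrm (Xi s' t' - Xi s' u - Xi u t') <= 8 * chi s' t' `^ (2 / p).
  move=> ss' s'u ut' t't.
  have us'm := leq_trans (inner_interval_lt ss' s'u ut' t't) (ltnSE tsm).
  have ul := leq_trans (ltnW ut') (leq_trans t't tl).
  have ks' := leq_trans ks ss'; have s'u' := ltnW s'u.
  have xu := solution_increment omP w_om xw lN small ks' s'u' ul.
  have xtu := solution_increment omP wt_om xtwt lN small ks' s'u' ul.
  have yu := IH _ _ us'm ks' s'u' ul.
  have ys : nrm (y s') <= S by apply: yS; rewrite ks' (leq_trans s'u' ul).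
  have regroup (a1 a2 a3 b1 b2 b3 : 'rV[R]_n) :
      a1 + b1 - (a2 + b2) - (a3 + b3) = (a1 - a2 - a3) + (b1 - b2 - b3).
    by apply/rowP => i; rewrite !mxE; ring.
  rewrite /Xi regroup.
  apply: le_trans (nrmD nrmP _ _) _.
  have d1 := nrm_germ_defect nrmP (F := fun mu j => f mu (x j) - f mu (xt j))
    w t' (fun mu => C2b_four_points nrmP (ltW L0) (fP mu) xu xtu).
  have d2 := nrm_germ_defect nrmP (F := fun mu j => f mu (xt j))
    (fun j => w j - wt j) t' (fun mu => C2b_lipschitz nrmP (fP mu) (xt s') (xt u)).
  have m1 := control_root_mono omP (leqnn s') (ltnW s'u) (ltnW ut').
  have m2 := control_root_mono omP (ltnW s'u) (ltnW ut') (leqnn t').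
  have m3 := control_root_mono kaP (leqnn s') (ltnW s'u) (ltnW ut').
  have m4 := control_root_mono kaP (ltnW s'u) (ltnW ut') (leqnn t').
  have l1 := w_om (ltnW ut'); have l2 := dw_et (ltnW ut').
  apply: le_trans (lerD d1 d2) _; rewrite chiE.
  have o1 := om_ka s' u; have o2 := et_ka u t'.
  have b1 := l1norm_ge0 (w t' - w u).
  have b2 := l1norm_ge0 (w t' - wt t' - (w u - wt u)).
  have a1 := nrm_ge0 nrmP (y u - y s'); have a2 := nrm_ge0 nrmP (y s').
  have a3 := nrm_ge0 nrmP (xt u - xt s').
  have r0 := powR_ge0 (om s' u) (1 / p).
  move: xtu yu ys m1 m2 m3 m4 l1 l2 o1 o2 b1 b2 a1 a2 a3 r0.
  rewrite -/(y u) -/(y s'); set b := l1norm (w t' - wt t' - _).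
  move: b (l1norm (w t' - w u)) (nrm (y u - y s')) (nrm (y s')) (nrm (xt u - xt s')).
  move: (om s' u `^ _) (om u t' `^ _) (om s' t' `^ _) (ka s' u `^ _) (ka u t' `^ _)
    (ka s' t' `^ _) (et u t' `^ _) => r1 r2 r k1 k2 K e2 b a yy ys xx.
  move=> xxr yyk ysS r1r r2r k1K k2K ar be Sk ek a0 b0 yy0 ys0 xx0 r10.
  have K0 : 0 <= K.
    by apply: (le_trans _ k1K); apply: (le_trans _ Sk); rewrite mulr_ge0.
  have la0 : 0 <= L * a by rewrite mulr_ge0 ?(ltW L0).
  have lb0 : 0 <= L * b by rewrite mulr_ge0 ?(ltW L0).
  clear d1 d2 IH.
  (* The constant 8 of the defect is 4 from the increment of [y], 2 from the curvature term of the
     four-point estimate, and 2 from [w - wt]. *)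
  have h1 : yy * (L * a) <= (4 * K) * r by apply: ler_pM => //; lra.
  have h2 : (r1 * ys) * (L * a) <= K * r.
    apply: ler_pM; [exact: mulr_ge0|by []| |by lra].
    by apply: (le_trans _ k1K); apply: (le_trans _ Sk); rewrite mulrC; exact: ler_wpM2r.
  have h3 : xx * (L * b) <= (2 * r) * K by apply: ler_pM => //; lra.
  by lra.
have sum_Xi : \sum_(s <= j < t) Xi j j.+1 = y t - y s.
  apply: telescope_sumr_eq; first exact: ltnW.
  by move=> j /andP[_ jt]; rewrite diff_step// (leq_trans jt (leq_trans tl lN)).
have chiP : control chi by exact: control_geometric_mean.
have tsN := leq_trans (leq_subr s t) (leq_trans tl lN).
have := sewing nrmP (N := N) chiP ip20 (ler0n R 8) Xi_defect (leqnn s) st (leqnn t).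
rewrite sum_Xi -/(CpN p N) -/C chiE => /(_ tsN) sew.
have Xi_st : nrm (Xi s t) <= S * om s t `^ (1 / p) + et s t `^ (1 / p).
  by apply: nrm_germ_diff; [exact: ltnW|apply: yS; rewrite ks (leq_trans (ltnW st) tl)].
have := control_root_mono omP ks (ltnW st) tl.
have r0 := powR_ge0 (om s t) (1 / p); have K0 := powR_ge0 (ka s t) (1 / p).
have o1 := om_ka s t; have o2 := et_ka s t.
rewrite -(subrK (Xi s t) (y t - y s)); move: sew Xi_st r0 K0 o1 o2.
have := nrmD nrmP (y t - y s - Xi s t) (Xi s t).
move: (om s t `^ (1 / p)) (ka s t `^ (1 / p)) (et s t `^ (1 / p)).
move=> r K e n1 n2 n3 r0 K0 o1 o2 rle.
have : 4 * C * r <= 1 by apply: le_trans small; exact: ler_wpM2l.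
by move=> /(ler_wpM2l K0); lra.
Qed.

Let E := et 0%N N `^ (1 / p).

(** Take for [S] the maximum of the norm of [y] on the block, attained at [j]. Then [S] is at most
    [nrm (y k) + 4 * S * om^(1/p) + 4 * E], and smallness with [C >= 2] makes the middle term at
    most [S / 2]. *)
Lemma diff_small_block k l : (k <= l)%N -> (l <= N)%N ->
  4 * C * om k l `^ (1 / p) <= 1 -> nrm (y l) <= 2 * nrm (y k) + 8 * E.
Proof.
move=> kl lN small.
have [i _ imax] := @arg_maxP _ _ _ (@ord0 (l - k)) predT
  (fun i : 'I_(l - k).+1 => nrm (y (k + i))) isT.
set j := (k + i)%N; have jl : (j <= l)%N 
  by rewrite -(subnKC kl) leq_add2l -ltnS.
have yj a : (k <= a <= l)%N -> nrm (y a) <= nrm (y j).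
  move=> /andP[ka al]; 
  have ak : (a - k < (l - k).+1)%N by rewrite ltnS leq_sub2r.
  by have := imax (Ordinal ak) isT; rewrite /= subnKC.
have yj0 := nrm_ge0 nrmP (y j).
have kj : (k <= j)%N by exact: leq_addr.
have inc := diff_increment lN small yj0 yj (leqnn k) kj jl.
have rk := control_root_mono omP (leqnn k) kj jl.
have ek : et k j `^ (1 / p) <= E.
  exact: control_root_mono etP (leq0n k) kj (leq_trans jl lN).
have r8 : 8 * om k j `^ (1 / p) <= 1.
  by apply: le_trans small; apply: ler_pM => //; [exact: powR_ge0|have := C2; lra].
have sub := rootR_subadd
  (mulr_ge0 (powR_ge0 (nrm (y j)) p) (omP.1 k j)) (etP.1 k j) p1.
rewrite powRM ?powR_ge0 ?omP.1// powRK// in sub.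
have yl : nrm (y l) <= nrm (y j) by apply: yj; rewrite kl leqnn.
have := nrmD nrmP (y j - y k) (y k); rewrite subrK => tri.
by have := ler_wpM2l yj0 r8; lra.
Qed.

Lemma diff_one_step j : (j < N)%N ->
  nrm (y j.+1) <= (1 + om j j.+1 `^ (1 / p)) * nrm (y j) + E.
Proof.
move=> jN; have := nrm_germ_diff (leqnSn j) (lexx (nrm (y j))).
rewrite -diff_step//.
have ek : et j j.+1 `^ (1 / p) <= E.
  exact: control_root_mono etP (leq0n j) (leqnSn j) jN.
have := nrmD nrmP (y j.+1 - y j) (y j); rewrite subrK.
by lra.
Qed.

(* Splitting at the first [q] with [4 C om(k,q)^(1/p) > 1] leaves a small block
   followed by a single, possibly large, step. *)
Lemma diff_chain c : 0 <= c ->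
  (forall s t, 1 < 4 * C * om s t `^ (1 / p) ->
     3 * (4 * C * om s t `^ (1 / p)) <= c * om s t) ->
  forall k l, (k <= l)%N -> (l <= N)%N ->
  nrm (y l) + 8 * E <= 2 * expR (c * om k l) * (nrm (y k) + 8 * E).
Proof.
move=> c0 cP k l; have E0 : 0 <= E := powR_ge0 _ _.
have [m] := ubnP (l - k); elim: m k => // m IH k lkm kl lN.
have yk0 := nrm_ge0 nrmP (y k).
(* A small remaining block ends the chain; only here is the factor 2 of the conclusion spent. *)
have [small|big] := leP (4 * C * om k l `^ (1 / p)) 1.
  have := diff_small_block kl lN small.
  have e1 : 1 <= expR (c * om k l).
    by rewrite -expR0 ler_expR mulr_ge0 ?omP.1.
  have z0 : 0 <= nrm (y k) + 8 * E by lra.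
  by have := ler_wpM2r z0 e1; lra.
have [kl'|kl'] := eqVneq k l.
  rewrite -kl' in big *.
  have o1 : 1 <= expR (c * om k k) by rewrite -expR0 ler_expR mulr_ge0 ?omP.1.
  have z0 : 0 <= nrm (y k) + 8 * E by lra.
  by have := ler_wpM2r z0 o1; lra.
have ex : exists q, (k < q)%N && (1 < 4 * C * om k q `^ (1 / p)).
  by exists l; apply/andP; split; rewrite // ltn_neqAle kl' kl.
have [q /andP[kq bigq] qmin] := ex_minnP ex.
have ql : (q <= l)%N 
  by apply: qmin; apply/andP; split; rewrite // ltn_neqAle kl' kl.
case: q => // q in kq bigq qmin ql *.
(* By minimality of [q.+1] the block from [k] to [q] is small, unless it is the single point [k]. *)
have yq : nrm (y q) <= 2 * nrm (y k) + 8 * E.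
  have [->|kq'] := eqVneq k q; first by have := nrm_ge0 nrmP (y q); lra.
  apply: (diff_small_block (ltnSE kq) (leq_trans (ltnW ql) lN)).
  rewrite leNgt; apply/negP => bq.
  suff /qmin : (k < q)%N && (1 < 4 * C * om k q `^ (1 / p)) by rewrite ltnn.
  by apply/andP; split; rewrite // ltn_neqAle kq' (ltnSE kq).
have yq0 := nrm_ge0 nrmP (y q).
have step : nrm (y q.+1) <= (1 + om q q.+1 `^ (1 / p)) * nrm (y q) + E.
  exact: diff_one_step (leq_trans ql lN).
have rq := control_root_mono omP (ltnSE kq) (leqnSn q) (leqnn q.+1).
have r0 := powR_ge0 (om q q.+1) (1 / p).
have r80 : 8 * om k q.+1 `^ (1 / p) <= 4 * C * om k q.+1 `^ (1 / p).
  by apply: ler_wpM2r; [exact: powR_ge0|have := C2; lra].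
have ex1 := expR_ge1Dx (c * om k q.+1).
have cq := cP _ _ bigq.
(* Since [Q > 1], the block and the step together cost at most [1 + 3 * Q <= 1 + c * om(k,q.+1)],
   hence a pure exponential without a factor 2; this is why [cP] asks for the constant 3. *)
have zq : nrm (y q.+1) + 8 * E <= expR (c * om k q.+1) * (nrm (y k) + 8 * E).
  set Q := 4 * C * om k q.+1 `^ (1 / p) in bigq r80 cq.
  have h1 : om q q.+1 `^ (1 / p) * nrm (y q) <= Q / 8 * (2 * nrm (y k) + 8 * E).
    by apply: ler_pM => //; lra.
  have z0 : 0 <= nrm (y k) + 8 * E by lra.
  have h2 : (1 + 3 * Q) * (nrm (y k) + 8 * E) <=
      expR (c * om k q.+1) * (nrm (y k) + 8 * E) by apply: ler_wpM2r => //; lra.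
  have h3 := ler_wpM2r yk0 (ltW bigq); have h4 := ler_wpM2r E0 (ltW bigq).
  by lra.
have lqm : (l - q.+1 < m)%N.
  by apply: leq_trans (ltnSE lkm); apply: ltn_sub2l => //; exact: leq_trans ql.
apply: le_trans (IH q.+1 lqm ql lN) _.
have : expR (c * om q.+1 l) * expR (c * om k q.+1) <= expR (c * om k l).
  rewrite -expRD ler_expR -mulrDr; apply: ler_wpM2l => //.
  by rewrite addrC; apply: omP.2 => //; exact: ltnW.
have z0 : 0 <= nrm (y k) + 8 * E by lra.
move=> /(ler_wpM2r z0).
by have := ler_wpM2l (expR_ge0 (c * om q.+1 l)) zq; lra.
Qed.

End Stability.

(** * Lower bounds on the constants *)

Section Constants.
Variable R : realType.
Implicit Types p o : R.

Lemma CpN_ge2 p N : 1 <= p -> p <= 2 -> (0 < N)%N -> 2 <= CpN p N.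
Proof.
move=> p1 p2 N0; have p0 : 0 < p by lra.
have h1 : 2 <= 2 `^ (2 / p) :> R.
  by rewrite -{1}(@powRr1 _ 2)//; apply: ler_powR; rewrite ?ler1n// ler_pdivlMr ?mul1r.
have h2 : 1 <= zetaN N (2 / p).
  by apply: le_trans (le_zetaN _ N0); rewrite /zetaN big_nat1 powR1.
rewrite /CpN -[leLHS]mulr1; apply: ler_pM => //.
Qed.

Lemma expR2_ge3 : 3 <= expR 2 :> R.
Proof. by have := @expR_ge1Dx R 2; lra. Qed.

Lemma cpN_ge0 p N : 0 <= cpN p N.
Proof. by rewrite mulr_ge0 ?addr_ge0 ?mulr_ge0 ?powR_ge0. Qed.

Lemma cpN_root_ge p N : 1 <= p -> 8 <= cpN p N `^ (1 / p).
Proof.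
move=> p1; have e3 := expR2_ge3; have p0 : 0 < p by lra.
apply: (@le_trans _ _ (4 * expR 2)); first lra.
apply: le_rootR; [by []|by lra|].
by rewrite /cpN ler_peMr ?powR_ge0// lerDr mulr_ge0 ?powR_ge0.
Qed.

(** With [Q = 4 * C * o^(1/p) > 1], [Q] is at most its p-th power [4^p * C^p * o], and the
    exponential factor in [cpN] supplies the 3. *)
Lemma cpN_large p N o : 1 <= p -> 0 <= CpN p N -> 0 <= o ->
  1 < 4 * CpN p N * o `^ (1 / p) ->
  3 * (4 * CpN p N * o `^ (1 / p)) <= cpN p N * o.
Proof.
rewrite /cpN; move: (CpN p N) => C p1 C0 o0 /ltW q1; have p0 : 0 < p by lra.
have e3 := expR2_ge3.
have e1 : 1 <= expR 2 :> R by lra.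
apply: le_trans (ler_wpM2l _ (le1r_powR q1 p1)) _ => //.
rewrite powRM ?powR_ge0 ?mulr_ge0// rootRK// mulrA.
apply: ler_wpM2r => //.
rewrite !powRM ?expR_ge0//.
have E3 : 3 <= expR 2 `^ p := le_trans e3 (le1r_powR e1 p1).
have F1 : 1 <= 4 `^ (p - 1) :> R.
  by rewrite -{1}(@powRr0 _ 4) ler_powR ?ler1n// subr_ge0.
have P0 := powR_ge0 (4 : R) p; have Q0 := powR_ge0 C p.
rewrite mulrC [4 `^ p * _ `^ p * _]mulrAC -!mulrA; apply: ler_wpM2l => //.
rewrite mulrC [leRHS]mulrC; apply: ler_pM => //.
have := ler_wpM2r Q0 F1; lra.
Qed.

End Constants.

(** * The stability estimate for time series *)

Theorem theorem5p4 (R : realType) (p : R) (N d n : nat)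
  (nrm : 'rV[R]_n -> R) (f : 'I_d -> 'rV[R]_n -> 'rV[R]_n) (L : R)
  (w wt : nat -> 'rV[R]_d) (xi xit : 'rV[R]_n) (x xt : nat -> 'rV[R]_n) :
  1 <= p -> p < 2 -> (0 < d)%N -> (0 < n)%N -> is_norm nrm -> 0 < L ->
  (forall mu, C2b_le nrm (f mu) L) ->
  x 0%N = xi ->
  (forall k, (k < N)%N ->
     x k.+1 = x k + \sum_(mu < d) (w k.+1 0 mu - w k 0 mu) *: f mu (x k)) ->
  xt 0%N = xit ->
  (forall k, (k < N)%N ->
     xt k.+1 = xt k + \sum_(mu < d) (wt k.+1 0 mu - wt k 0 mu) *: f mu (xt k)) ->
  forall k, (k <= N)%N ->
    nrm (x k - xt k) <=
      2 * (cpN p N) `^ (1 / p)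
        * expR (cpN p N * L `^ p
                 * ((pvar p w 0 N) `^ p + (pvar p wt 0 N) `^ p))
        * (nrm (xi - xit) + L * pvar p (fun j => w j - wt j) 0 N).
Proof.
move=> p1 p2 _ _ nrmP L0 fP x0 xw xt0 xtwt k kN.
have p0 : 0 < p by lra.
have Lp0 : 0 <= L `^ p := powR_ge0 L p.
pose om s t := L `^ p * pvarp p w s t + L `^ p * pvarp p wt s t.
pose et s t := L `^ p * pvarp p (fun j => w j - wt j) s t.
have omP : control om.
  by apply: control_add; apply: control_scale => //; exact: pvarp_control.
have etP : control et by apply: control_scale => //; exact: pvarp_control.
have root_le (v : nat -> 'rV[R]_d) s t : (s <= t)%N ->
    (L * l1norm (v t - v s)) `^ p <= L `^ p * pvarp p v s t.
  move=> st; rewrite powRM ?l1norm_ge0 ?(ltW L0)// ler_wpM2l//.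
  exact: l1norm_le_pvarp.
have Ll0 (v : 'rV[R]_d) : 0 <= L * l1norm v.
  by rewrite mulr_ge0 ?l1norm_ge0 ?(ltW L0).
have V0 (v : nat -> 'rV[R]_d) s t : 0 <= L `^ p * pvarp p v s t.
  by rewrite mulr_ge0 ?pvarp_ge0.
have w_om : dominated p L w om.
  move=> s t /(root_le w) st; apply: le_rootR; [exact: p0|exact: Ll0|].
  by apply: le_trans st _; rewrite /om lerDl; exact: V0.
have wt_om : dominated p L wt om.
  move=> s t /(root_le wt) st; apply: le_rootR; [exact: p0|exact: Ll0|].
  by apply: le_trans st _; rewrite /om lerDr; exact: V0.
have dw_et : dominated p L (fun j => w j - wt j) et.
  by move=> s t /(root_le (fun j => w j - wt j)) st; exact: le_rootR.
have solvesP (z : nat -> 'rV[R]_n) (v : nat -> 'rV[R]_d) : (forall j, (j < N)%N ->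
    z j.+1 = z j + \sum_(mu < d) (v j.+1 0 mu - v j 0 mu) *: f mu (z j)) ->
    solves N f z v.
  move=> zv j /zv ->; congr (_ + _); apply: eq_bigr => mu _.
  by rewrite !mxE.
have EE : et 0%N N `^ (1 / p) = L * pvar p (fun j => w j - wt j) 0 N.
  by rewrite /et powRM ?pvarp_ge0// powRK// ltW.
have omE : cpN p N * L `^ p * ((pvar p w 0 N) `^ p + (pvar p wt 0 N) `^ p) =
    cpN p N * om 0%N N.
  rewrite (congr2 +%R (pvar_powR w p1 0 N) (pvar_powR wt p1 0 N)) -mulrA.
  by congr (_ * _); exact: mulrDr.
rewrite omE -EE {omE EE root_le V0 Ll0}; clearbody om et; set E := et _ _ `^ _; have E0 : 0 <= E := powR_ge0 _ _.
have c8 := cpN_root_ge N p1; have c0 := cpN_ge0 p N.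
have y00 := nrm_ge0 nrmP (xi - xit).
have chain : nrm (x k - xt k) + 8 * E <=
    2 * expR (cpN p N * om 0%N k) * (nrm (xi - xit) + 8 * E).
  (* For [N = 0] the zeta sum is empty and [CpN] vanishes, so the bound [2 <= CpN p N] fails and the
     only index [k = 0] is treated directly. *)
  rewrite -x0 -xt0; have [N0|N0] := posnP N.
    have -> : k = 0%N by move: kN; rewrite N0 leqn0 => /eqP.
    have := expR_ge1Dx (cpN p N * om 0%N 0%N); have := mulr_ge0 c0 (omP.1 0%N 0%N).
    move=> o0 oe; rewrite -[leLHS]mul1r; apply: ler_wpM2r; last by lra.
    by rewrite x0 xt0; lra.
  have C2 := CpN_ge2 p1 (ltW p2) N0.
  apply: (diff_chain p1 nrmP L0 fP C2 omP etP w_om wt_om dw_et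
    (solvesP _ _ xw) (solvesP _ _ xtwt) c0) => //.
  by move=> s t; apply: cpN_large => //; [lra|exact: omP.1].
have ek : expR (cpN p N * om 0%N k) <= expR (cpN p N * om 0%N N).
  by rewrite ler_expR ler_wpM2l// control_mono.
apply: le_trans (_ : _ <= nrm (x k - xt k) + 8 * E) _; first by rewrite lerDl; lra.
apply: le_trans chain _.
have z0 : 0 <= nrm (xi - xit) + 8 * E by lra.
(* The prefactor [cpN^(1/p)], being at least 8, absorbs the 8 in front of [E]. *)
have z8 : nrm (xi - xit) + 8 * E <= cpN p N `^ (1 / p) * (nrm (xi - xit) + E).
  by have := ler_wpM2r y00 c8; have := ler_wpM2r E0 c8; lra.
by have := ler_pM (expR_ge0 _) z0 ek z8; lra.
Qed.
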